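(* Let $P=\Gamma_{k,k+1}$ for some $1\le k<N$. Then $P$ cannot be extended to a subdivision of $\Delta$ with a circuit of type D that is dual to a surface $S\in\mathrm{Sing}^{\mathrm{tr}}(\Delta,\overline x)$.
   Context: General setting. $\mathbb K=\bigcup_{m\ge1}\mathbb C\{t^{1/m}\}$ is the field of locally convergent Puiseux series with $\mathrm{Val}(\sum_r a_rt^r)=-\min\{r:a_r\ne0\}$. $\Delta\subset\mathbb R^3$ is a convex lattice polytope such that the differences of points of $\Delta\cap\mathbb Z^3$ generate $\mathbb Z^3$; $N=|\Delta\cap\mathbb Z^3|-2>0$. $\mathrm{Sing}(\Delta)$ is the family of surfaces defined by Laurent polynomials over $\mathbb K$ with support in $\Delta$ having a singular point in $(\mathbb K^* )^3$; $\Delta$ is assumed non-defective, i.e. $\mathrm{Sing}(\Delta)$ is a hypersurface in the $(N+1)$-dimensional linear system. A tropical surface $S$ with Newton polytope $\Delta$ is the corner locus of $F_S(X)=\max_{\omega\in\Delta\cap\mathbb Z^3}(c_\omega+\langle\omega,X\rangle)$; $\nu_S:\Delta\to\mathbb R$ is the Legendre dual convex piecewise linear function (its graph is the lower part of the convex hull of the points $(\omega,-c_\omega)$) and $\Sigma_S$ is the dual subdivision of $\Delta$ into linearity domains of $\nu_S$. $\mathrm{Sing}^{\mathrm{tr}}(\Delta)$ is the set of tropicalizations of surfaces in $\mathrm{Sing}(\Delta)$. Point configuration (Mikhalkin's position). Fix $v\in\mathbb Q^3$ that is not parallel or orthogonal to any proper affine subspace of $\mathbb R^3$ spanned by a subset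 of $\Delta\cap\mathbb Z^3$. Write $u\succ u'$ iff $\langle u-u',v\rangle>0$; this linearly orders $\Delta\cap\mathbb Z^3=\{w_0\prec w_1\prec\dots\prec w_{N+1}\}$. $\overline x=(x_1,\dots,x_N)$ with $x_i=M_iv$, $M_i$ rational, $0\ll M_1\ll\dots\ll M_N$ ($M_1$ and the ratios $M_{i+1}/M_i$ exceed a sufficiently large constant depending only on $\Delta$ and $v$). $\mathrm{Sing}^{\mathrm{tr}}(\Delta,\overline x)=\{S\in\mathrm{Sing}^{\mathrm{tr}}(\Delta): S\supset\overline x\}$. It is known that this set is finite, all its elements are of maximal-dimensional geometric type (deformation space of dimension $N$), each $x_i$ is an interior point of a 2-face $F_i$ of $S$, and the $F_i$ are distinct. Circuits. A circuit is an affinely dependent set of lattice points all of whose proper subsets are affinely independent. It is known that $\Sigma_S$, for $S\in\mathrm{Sing}^{\mathrm{tr}}(\Delta,\overline x)$, has a unique circuit $C_S$. It is of type D if $\mathrm{Conv}(C_S)$ is a parallelogram whose vertices are its only lattice points and form $C_S$ (equivalent under affine automorphisms of $\mathbb Z^3$ to $\{(0,0,0),(1,0,0),(0,1,0),(1,1,0)\}$). Lattice paths. For $A=\{a_1\prec\dots\prec a_m\}\subset\Delta\cap\mathbb Z^3$, $P(A)$ is the set of segments $[a_i,a_{i+1}]$, $1\le i<m$. $\Gamma_{k,k+1}=P(\{w_0,\dots,w_k\})\cup P(\{w_{k+1},\dots,w_{N+1}\})$. For $S\in\mathrm{Sing}^{\mathrm{tr}}(\Delta,\overline x)$, $P(S,\overline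 x)=\{e_1,\dots,e_N\}$, where $e_i$ is the edge of $\Sigma_S$ dual to $F_i$. A path $P$ extends to a subdivision $\Sigma$ dual to $S$ if $\Sigma=\Sigma_S$ and $P=P(S,\overline x)$. *)

(* Defs.v *)
From HB Require Import structures.
From mathcomp Require Import all_boot all_order all_algebra.
From mathcomp Require Import complex.
From mathcomp Require Import all_classical all_reals all_analysis.
From mathcomp Require mpoly.
From mathcomp Require Import ring lra zify.
Set Implicit Arguments.
Unset Strict Implicit.
Unset Printing Implicit Defensive.
Import Order.TTheory GRing.Theory Num.Theory numFieldNormedType.Exports.
Import ComplexField.Normc.
Local Open Scope ring_scope.
Local Open Scope classical_set_scope.

Section Puiseux.
Variable R : realType.
Local Notation C := R[i].

(* [a : nat -> C] are the coefficients of a power series in the uniformiser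
   [t^(1/m)]; it converges near 0 iff it converges absolutely at
   some [rho > 0]. *)
Definition locally_convergent (a : nat -> C) : Prop :=
  exists2 rho : R, 0 < rho & cvgn (series (fun k => normc (a k) * rho ^+ k)).

Definition pexp (m : nat) (n : int) (k : nat) : rat := (n + k%:Z)%:~R / m%:R.

(* [a r] is the coefficient of [t^r]; as K is a field, the series in
   [C{t^(1/m)}] may start with finitely many negative powers of [t^(1/m)]. *)
Definition is_puiseux (a : rat -> C) : Prop :=
  exists (m : nat) (n : int), [/\ (0 < m)%N,
    (forall r, a r != 0 -> exists k, r = pexp m n k) &
    locally_convergent (fun k => a (pexp m n k))].

Record puiseux : Type := Puiseux {
  pcoef :> rat -> C;
  pcoefP : is_puiseux pcoef }.

Lemma puiseux_inj (x y : puiseux) : pcoef x =1 pcoef y -> x = y.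
Proof.
case: x y => a ha [b hb] /= /funext e; rewrite e in ha *.
by congr Puiseux; exact: Prop_irrelevance.
Qed.

HB.instance Definition _ := gen_eqMixin puiseux.
HB.instance Definition _ := gen_choiceMixin puiseux.

Definition geom (a : nat -> C) :=
  exists2 B : R, 1 <= B & forall k, normc (a k) <= B ^+ k.+1.

Lemma normc_ge0 (x : C) : 0 <= normc x.
Proof. by case: x => u v; rewrite /= sqrtr_ge0. Qed.

Lemma normcD (x y : C) : normc (x + y) <= normc x + normc y.
Proof. exact: le_normcD. Qed.

Lemma normc_sum n (F : 'I_n -> C) : normc (\sum_i F i) <= \sum_i normc (F i).
Proof.
elim/big_ind2: _ => //=; first by rewrite expr0n/= addr0 sqrtr0.
move=> x1 x2 y1 y2 h1 h2; exact: le_trans (normcD _ _) (lerD h1 h2).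
Qed.

Lemma exp_mono (B D : R) i j : 1 <= B -> B <= D -> (i <= j)%N -> B ^+ i <= D ^+ j.
Proof.
move=> B1 BD ij; have B0 : 0 <= B by lra.
apply: (@le_trans _ _ (B ^+ j)); first by rewrite ler_weXn2l.
by apply: lerXn2r => //; rewrite nnegrE; lra.
Qed.

Lemma locally_convergentP a : locally_convergent a <-> geom a.
Proof.
split.
  case=> rho rho0 /cvg_series_cvg_0/cvgP/cvg_seq_bounded [M [_ hM]].
  have {hM}/= hM := hM (Num.max M 0 + 1).
  set M' := Num.max M 0 + 1 in hM.
  have M0 : 0 <= Num.max M 0 by rewrite le_max lexx orbT.
  have MM : M <= Num.max M 0 by rewrite le_max lexx.
  have {}hM k : normc (a k) * rho ^+ k <= M'.
    apply: le_trans (ler_norm _) _; apply: hM => //; rewrite /M'; lra.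
  have ri : 0 < rho^-1 by rewrite invr_gt0.
  exists (1 + M' + rho^-1); first by rewrite /M'; lra.
  move=> k; have -> : normc (a k) = normc (a k) * rho ^+ k * rho^-1 ^+ k.
    by rewrite -mulrA -exprMn divff ?expr1n ?mulr1 // gt_eqF.
  rewrite exprS; apply: ler_pM.
  - by rewrite mulr_ge0 ?normc_ge0 // exprn_ge0 // ltW.
  - by rewrite exprn_ge0 // ltW.
  - by apply: le_trans (hM k) _; rewrite /M'; lra.
  - by apply: lerXn2r; rewrite ?nnegrE /M'; lra.
case=> B B1 hB; have B0 : 0 < B by lra.
have ri : 0 < (2 * B)^-1 by rewrite invr_gt0; lra.
exists (2 * B)^-1 => //.
apply: (@series_le_cvg _ _ (geometric B (2^-1))).
- by move=> k; rewrite mulr_ge0 ?normc_ge0 // exprn_ge0 // ltW.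
- by move=> k /=; rewrite mulr_ge0 ?exprn_ge0 //; lra.
- move=> k /=; rewrite invfM exprMn mulrCA [_ * 2^-1 ^+ k]mulrC.
  apply: ler_wpM2l; first by rewrite exprn_ge0 //; lra.
  rewrite exprVn ler_pdivrMr ?exprn_gt0 //; have := hB k.
  by rewrite exprS.
- by apply: is_cvg_geometric_series; rewrite ger0_norm; lra.
Qed.

(* The series [\sum_k a k t^((n + k)/m)]. *)
Definition emb m n (a : nat -> C) : rat -> C :=
  fun r => if pselect (exists k, r = pexp m n k) is left h
    then a (projT1 (cid h)) else 0.

Lemma pexp_inj m n j k : (0 < m)%N -> pexp m n j = pexp m n k -> j = k.
Proof.
move=> m0; rewrite /pexp.
have mz : (m%:R : rat)^-1 != 0 by rewrite invr_eq0 pnatr_eq0 -lt0n.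
by move/(mulIf mz)/eqP; rewrite eqr_int => /eqP/addrI [].
Qed.

Lemma embE m n a k : (0 < m)%N -> emb m n a (pexp m n k) = a k.
Proof.
move=> m0; rewrite /emb; case: pselect => [h|[]]; last by exists k.
by case: (cid h) => j /= /(pexp_inj m0) ->.
Qed.

Lemma emb0 m n a r : ~ (exists k, r = pexp m n k) -> emb m n a r = 0.
Proof. by rewrite /emb; case: pselect. Qed.

Lemma embP m n (a : nat -> C) (f : rat -> C) : (0 < m)%N ->
  (forall k, f (pexp m n k) = a k) ->
  (forall r, ~ (exists k, r = pexp m n k) -> f r = 0) -> f = emb m n a.
Proof.
move=> m0 h1 h2; apply/funext => r.
have [[k ->]|h] := pselect (exists k, r = pexp m n k); first by rewrite embE.
by rewrite h2 // emb0.
Qed.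

Definition rep m n (f : rat -> C) := exists2 a, geom a & f = emb m n a.

Lemma is_puiseuxP f : is_puiseux f <-> exists m n, (0 < m)%N /\ rep m n f.
Proof.
split=> [[m [n [m0 h /locally_convergentP g]]]|[m [n [m0 [a g ->]]]]].
  exists m, n; split => //; exists (fun k => f (pexp m n k)) => //.
  apply: embP => // r hr; apply/eqP; apply: contra_notT hr; exact: h.
exists m, n; split=> //.
  by move=> r; apply: contra_neqP => /emb0 ->.
apply/locally_convergentP; case: g => B B1 h; exists B => // k.
by rewrite embE.
Qed.

Lemma geom_le a b : (forall k, normc (a k) = 0 \/ exists2 j, (j <= k)%N & a k = b j) ->
  geom b -> geom a.
Proof.
move=> h [B B1 hB]; exists B => // k; case: (h k) => [->|[j jk ->]].
  by rewrite exprn_ge0; lra.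
by apply: le_trans (hB j) _; apply: exp_mono.
Qed.

Lemma rep_refine m n f p n' : (0 < m)%N -> (0 < p)%N -> n' <= n * p%:Z ->
  rep m n f -> rep (m * p)%N n' f.
Proof.
move=> m0 p0 le [a ga ->].
pose d := absz (n * p%:Z - n')%R.
have dE : n * p%:Z = n' + d%:Z by rewrite /d; lia.
have eE k : pexp m n k = pexp (m * p)%N n' (k * p + d)%N.
  rewrite /pexp; have -> : n' + (k * p + d)%N%:Z = (n + k%:Z) * p%:Z by lia.
  rewrite rmorphM natrM /=.
  by field; rewrite ?pnatr_eq0; lia.
exists (fun j => if (d <= j)%N && (p %| j - d)%N then a ((j - d) %/ p)%N else 0).
  apply: geom_le ga => k; case: ifP => [_|_]; last first.
    by left; exact: normc0.
  by right; exists ((k - d) %/ p)%N => //; apply: leq_trans (leq_div _ _) (leq_subr _ _).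
apply: embP; first by rewrite muln_gt0 m0.
  move=> j; case: ifP => [/andP[dj /dvdnP[q pq]]|hj].
    have -> : j = (q * p + d)%N by rewrite -pq subnK.
    by rewrite -eE embE // addnK mulnK.
  apply: emb0 => -[k]; rewrite eE => /pexp_inj kE.
  by rewrite kE ?muln_gt0 ?m0 // leq_addl addnK dvdn_mull in hj.
move=> r hr; apply: emb0 => -[k rE]; apply: hr; rewrite rE eE; by eexists.
Qed.

Lemma rep3 (x y z : puiseux) : exists m n,
  [/\ (0 < m)%N, rep m n x, rep m n y & rep m n z].
Proof.
have /is_puiseuxP[m1 [n1 [m10 r1]]] := pcoefP x.
have /is_puiseuxP[m2 [n2 [m20 r2]]] := pcoefP y.
have /is_puiseuxP[m3 [n3 [m30 r3]]] := pcoefP z.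
pose N := - (`|n1| * (m2 * m3)%N%:Z + `|n2| * (m1 * m3)%N%:Z + `|n3| * (m1 * m2)%N%:Z).
have p1 : 0 <= `|n1| * (m2 * m3)%N%:Z by rewrite mulr_ge0.
have p2 : 0 <= `|n2| * (m1 * m3)%N%:Z by rewrite mulr_ge0.
have p3 : 0 <= `|n3| * (m1 * m2)%N%:Z by rewrite mulr_ge0.
have q (u : int) (v : nat) : - (`|u| * v%:Z) <= u * v%:Z.
  by rewrite -mulNr ler_wpM2r //; lia.
have q1 := q n1 (m2 * m3)%N; have q2 := q n2 (m1 * m3)%N; have q3 := q n3 (m1 * m2)%N.
exists (m1 * m2 * m3)%N, N; split; first by rewrite !muln_gt0 m10 m20.
- rewrite -mulnA; apply: rep_refine r1; rewrite ?muln_gt0 ?m20 //; rewrite /N; lia.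
- rewrite [(m1 * m2)%N]mulnC -mulnA; apply: rep_refine r2; rewrite ?muln_gt0 ?m10 //; rewrite /N; lia.
- rewrite mulnC; apply: rep_refine r3; rewrite ?muln_gt0 ?m10 //; rewrite /N; lia.
Qed.

Definition cauchy_prod (a b : nat -> C) : nat -> C :=
  fun k => \sum_(i < k.+1) a i * b (k - i)%N.
Definition tr N (a : nat -> C) : {poly C} := \poly_(i < N) a i.

Lemma trE N a k : (k < N)%N -> (tr N a)`_k = a k.
Proof. by rewrite coef_poly => ->. Qed.

Lemma cauchy_prodE N a b k : (k < N)%N -> cauchy_prod a b k = (tr N a * tr N b)`_k.
Proof.
move=> kN; rewrite coefM; apply: eq_bigr => i _.
rewrite !trE //; first exact: leq_ltn_trans (leq_subr _ _) kN.
by apply: leq_ltn_trans kN; rewrite -ltnS.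
Qed.

Lemma cauchy_prodC a b : cauchy_prod a b = cauchy_prod b a.
Proof. by apply/funext => k; rewrite !(@cauchy_prodE k.+1) // mulrC. Qed.

Lemma cauchy_prodA a b c : cauchy_prod a (cauchy_prod b c) = cauchy_prod (cauchy_prod a b) c.
Proof.
have ass (a' b' c' : nat -> C) k :
    cauchy_prod (cauchy_prod a' b') c' k = (tr k.+1 a' * tr k.+1 b' * tr k.+1 c')`_k.
  rewrite coefM; apply: eq_bigr => i _.
  by rewrite (@cauchy_prodE k.+1) // trE // ltnS leq_subr.
by apply/funext => k; rewrite cauchy_prodC !ass mulrC mulrA.
Qed.

Lemma cauchy_prodDl a b c : cauchy_prod (a \+ b) c = cauchy_prod a c \+ cauchy_prod b c.
Proof.
apply/funext => k; rewrite /cauchy_prod /= -big_split /=.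
by apply: eq_bigr => i _; rewrite mulrDl.
Qed.

Definition unit1 : nat -> C := fun k => (k == 0%N)%:R.

Lemma cauchy_prod1 a : cauchy_prod unit1 a = a.
Proof.
apply/funext => k; rewrite /cauchy_prod big_ord_recl /= subn0 big1 ?addr0 ?mul1r //.
by move=> i _; rewrite mul0r.
Qed.

Lemma geomD a b : geom a -> geom b -> geom (a \+ b).
Proof.
move=> [A A1 hA] [B B1 hB]; exists (A + B); first by lra.
move=> k; apply: le_trans (normcD _ _) _; apply: le_trans (lerD (hA k) (hB k)) _.
have A0 : 0 <= A by lra. have B0 : 0 <= B by lra.
rewrite [(A + B) ^+ _]exprS mulrDl !exprS; apply: lerD; apply: ler_wpM2l => //;
  by apply: lerXn2r; rewrite ?nnegrE; lra.
Qed.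

Lemma geomN a : geom a -> geom (fun k => - a k).
Proof. by case=> B B1 h; exists B => // k; rewrite normcN. Qed.

Lemma geom_cauchy_prod a b : geom a -> geom b -> geom (cauchy_prod a b).
Proof.
move=> [A A1 hA] [B B1 hB].
have AB : 1 <= A * B by rewrite -[1]mulr1 ler_pM //; lra.
exists (2 * (A * B) ^+ 2).
  by have := exp_mono (i := 0) (j := 2) AB (lexx _) isT; rewrite expr0; lra.
move=> k; apply: le_trans (normc_sum _) _.
apply: (@le_trans _ _ (\sum_(i < k.+1) (A * B) ^+ k.+2)).
  apply: ler_sum => i _; rewrite normcM.
  apply: le_trans (ler_pM (normc_ge0 _) (normc_ge0 _) (hA _) (hB _)) _.
  have ik : (i <= k)%N by rewrite -ltnS.
  rewrite exprMn; apply: ler_pM.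
  - by rewrite exprn_ge0; lra.
  - by rewrite exprn_ge0; lra.
  - by apply: exp_mono => //; lia.
  - by apply: exp_mono => //; lia.
rewrite sumr_const card_ord -[_ *+ _]mulr_natl [(2 * _) ^+ _]exprMn -exprM.
apply: ler_pM; rewrite ?ler0n //; first by rewrite exprn_ge0 //; lra.
  by rewrite -natrX ler_nat ltnW // ltn_expl.
by apply: exp_mono => //; lia.
Qed.

Lemma geom1 : geom unit1.
Proof.
exists 1 => // k; rewrite expr1n /unit1; case: eqP => _.
  by have /= -> := @normc1 R.
by have /= -> := @normc0 R.
Qed.

Lemma emb_add m n a b : (0 < m)%N ->
  (fun r => emb m n a r + emb m n b r) = emb m n (a \+ b).
Proof.
move=> m0; apply: embP => // [k|r h]; first by rewrite !embE.
by rewrite !emb0 // addr0.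
Qed.

(* The Cauchy product; its terms vanish for all but finitely many [s]. *)
Definition pmulf (f g : rat -> C) : rat -> C :=
  fun r => \sum_(s \in [set: rat]) f s * g (r - s).

Lemma pexpD m n n' i j : pexp m n i + pexp m n' j = pexp m (n + n') (i + j)%N.
Proof. by rewrite /pexp -mulrDl -rmorphD /= PoszD addrACA. Qed.

Lemma emb_mul m n n' a b : (0 < m)%N ->
  pmulf (emb m n a) (emb m n' b) = emb m (n + n') (cauchy_prod a b).
Proof.
move=> m0; apply: embP => // [k|r hr]; last first.
  rewrite /pmulf fsbig1 // => s _.
  have [[i si]|/emb0 ->] := pselect (exists k, s = pexp m n k); last by rewrite mul0r.
  have [[j sj]|/emb0 ->] := pselect (exists k, r - s = pexp m n' k); last by rewrite mulr0.
  by case: hr; exists (i + j)%N; rewrite -pexpD -si -sj addrC subrK.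
rewrite /pmulf /cauchy_prod.
have inj : injective (fun i : 'I_k.+1 => pexp m n i).
  by move=> i j /(pexp_inj m0)/val_inj.
rewrite (@fsbigE _ _ _ _ _ [seq pexp m n (i : 'I_k.+1) | i : 'I_k.+1]).
- rewrite big_map; under eq_bigl do rewrite in_setT.
  rewrite big_enum /=.
  apply: eq_bigr => i _; rewrite embE //; congr (_ * _).
  have ik : (i <= k)%N by rewrite -ltnS.
  by rewrite -[in pexp _ _ k](subnKC ik) -pexpD addrC addKr embE.
- by rewrite map_inj_uniq ?enum_uniq.
- by [].
- move=> s _ nz.
  have [[i si]|/emb0 ->] := pselect (exists k, s = pexp m n k); last by rewrite mul0r.
  rewrite [emb m n' b _]emb0 ?mulr0 // => -[j sj].
  have /(pexp_inj m0) kE : pexp m (n + n') k = pexp m (n + n') (i + j)%N.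
    by rewrite -pexpD -si -sj [s + _]addrC subrK.
  have ik : (i < k.+1)%N by rewrite kE ltnS leq_addr.
  by move/negP: nz; apply; rewrite si; apply/mapP; exists (Ordinal ik); rewrite ?mem_enum.
Qed.

Program Definition pzero := @Puiseux (fun=> 0) _.
Next Obligation.
exists 1%N, 0; split=> // [r|]; first by rewrite eqxx.
by apply/locally_convergentP; exists 1 => // k; rewrite expr1n; have /= -> := @normc0 R.
Qed.

Lemma pone_subproof : is_puiseux (fun r => (r == 0)%:R).
Proof.
apply/is_puiseuxP; exists 1%N, 0; split=> //; exists unit1; first exact: geom1.
apply: embP => // [k|r hr]; first by rewrite /pexp add0r divr1 /unit1 intr_eq0.
by case: eqP => // r0; case: hr; exists 0%N; rewrite r0 /pexp addr0 mul0r.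
Qed.
Definition pone := Puiseux pone_subproof.

Lemma padd_subproof (x y : puiseux) : is_puiseux (fun r => x r + y r).
Proof.
have [m [n [m0 [a ga xE] [b gb yE] _]]] := rep3 x y x.
apply/is_puiseuxP; exists m, n; split=> //; exists (a \+ b); first exact: geomD.
by rewrite -emb_add // xE yE.
Qed.
Definition padd x y := Puiseux (padd_subproof x y).

Lemma popp_subproof (x : puiseux) : is_puiseux (fun r => - x r).
Proof.
have [m [n [m0 [a ga xE] _ _]]] := rep3 x x x.
apply/is_puiseuxP; exists m, n; split=> //; exists (fun k => - a k); first exact: geomN.
rewrite xE; apply: embP => // [k|r h]; first by rewrite embE.
by rewrite emb0 // oppr0.
Qed.
Definition popp x := Puiseux (popp_subproof x).

Lemma pmul_subproof (x y : puiseux) : is_puiseux (pmulf x y).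
Proof.
have [m [n [m0 [a ga xE] [b gb yE] _]]] := rep3 x y x.
apply/is_puiseuxP; exists m, (n + n); split=> //.
exists (cauchy_prod a b); first exact: geom_cauchy_prod.
by rewrite -emb_mul // xE yE.
Qed.
Definition pmul x y := Puiseux (pmul_subproof x y).

Lemma paddA : associative padd.
Proof. by move=> x y z; apply: puiseux_inj => r /=; rewrite addrA. Qed.
Lemma paddC : commutative padd.
Proof. by move=> x y; apply: puiseux_inj => r /=; rewrite addrC. Qed.
Lemma padd0 : left_id pzero padd.
Proof. by move=> x; apply: puiseux_inj => r /=; rewrite add0r. Qed.
Lemma paddN : left_inverse pzero popp padd.
Proof. by move=> x; apply: puiseux_inj => r /=; rewrite addNr. Qed.

HB.instance Definition _ := GRing.isZmodule.Build puiseux paddA paddC padd0 paddN.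

Lemma pmulA : associative pmul.
Proof.
move=> x y z; apply: puiseux_inj => r /=.
have [m [n [m0 [a _ xE] [b _ yE] [c _ zE]]]] := rep3 x y z.
by rewrite xE yE zE !emb_mul // addrA cauchy_prodA.
Qed.

Lemma pmulC : commutative pmul.
Proof.
move=> x y; apply: puiseux_inj => r /=.
have [m [n [m0 [a _ xE] [b _ yE] _]]] := rep3 x y x.
by rewrite xE yE !emb_mul // cauchy_prodC.
Qed.

Lemma pone_emb m : (0 < m)%N -> pone = emb m 0 unit1 :> (rat -> C).
Proof.
move=> m0; apply: embP => // [k|r hr] /=.
  by rewrite /pexp add0r mulf_eq0 invr_eq0 !pnatr_eq0 [m == _]gtn_eqF // orbF.
by case: eqP => // r0; case: hr; exists 0%N; rewrite r0 /pexp addr0 mul0r.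
Qed.

Lemma pmul1 : left_id pone pmul.
Proof.
move=> x; apply: puiseux_inj => r.
have [m [n [m0 [a _ xE] _ _]]] := rep3 x x x.
by change (pmulf pone x r = x r); rewrite (pone_emb m0) xE emb_mul // add0r cauchy_prod1.
Qed.

Lemma pmulD : left_distributive pmul padd.
Proof.
move=> x y z; apply: puiseux_inj => r /=.
have [m [n [m0 [a _ xE] [b _ yE] [c _ zE]]]] := rep3 x y z.
by rewrite xE yE zE emb_add // !emb_mul // cauchy_prodDl -emb_add.
Qed.

Lemma pone_neq0 : pone != pzero.
Proof.
apply/eqP => /(congr1 (fun x : puiseux => x 0)) h.
by move/eqP: (oner_neq0 C); apply; exact: h.
Qed.

HB.instance Definition _ := GRing.Zmodule_isComNzRing.Build puiseux
  pmulA pmulC pmul1 pmulD pone_neq0.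

Fixpoint inv_seq (b : nat -> C) k : seq C :=
  if k is k'.+1 then
    let s := inv_seq b k' in rcons s (- (b 0%N)^-1 * \sum_(i < k') b (k' - i)%N * s`_i
      + (k' == 0%N)%:R / b 0%N)
  else [::].
Definition inv_coef b k := (inv_seq b k.+1)`_k.

Lemma size_inv_seq b k : size (inv_seq b k) = k.
Proof. by elim: k => //= k IH; rewrite size_rcons IH. Qed.

Lemma nth_inv_seq b k i : (i < k)%N -> (inv_seq b k)`_i = inv_coef b i.
Proof.
elim: k => // k IH; rewrite ltnS leq_eqVlt => /predU1P[-> //|ik].
by rewrite /= nth_rcons size_inv_seq ik IH.
Qed.

Lemma inv_coefE b k : inv_coef b k =
  - (b 0%N)^-1 * \sum_(i < k) b (k - i)%N * inv_coef b i + (k == 0%N)%:R / b 0%N.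
Proof.
rewrite {1}/inv_coef /= nth_rcons size_inv_seq ltnn eqxx.
by congr (_ * _ + _); apply: eq_bigr => i _; rewrite nth_inv_seq.
Qed.

Lemma cauchy_prod_inv b : b 0%N != 0 -> cauchy_prod (inv_coef b) b = unit1.
Proof.
move=> b0; apply/funext => k; rewrite /cauchy_prod big_ord_recr /= subnn [in X in _ + X]inv_coefE.
rewrite mulrDl divfK // [X in _ + (X + _)]mulrC mulrA mulrN divff // mulN1r.
rewrite addrA (_ : _ - _ = 0) ?add0r // -sumrB big1 // => i _.
by rewrite mulrC subrr.
Qed.

Lemma geom_inv b : b 0%N != 0 -> geom b -> geom (inv_coef b).
Proof.
move=> b0 [B B1 hB].
set e := normc (b 0%N)^-1; have e0 : 0 <= e by exact: normc_ge0.
pose D := B + e * B ^+ 2 + e + 1.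
have eB : 0 <= e * B ^+ 2 by rewrite mulr_ge0 // exprn_ge0; lra.
have D1 : 1 <= D by rewrite /D; lra.
have BD : B + e * B ^+ 2 <= D by rewrite /D; lra.
have S k : e * \sum_(i < k) B ^+ (k - i).+1 * D ^+ i.+1 <= D ^+ k.+1.
  elim: k => [|k IH]; first by rewrite big_ord0 mulr0 exprn_ge0; lra.
  rewrite big_ord_recr /= subSnn.
  have -> : \sum_(i < k) B ^+ (k.+1 - i).+1 * D ^+ i.+1 =
    B * \sum_(i < k) B ^+ (k - i).+1 * D ^+ i.+1.
    rewrite big_distrr /=; apply: eq_bigr => i _; rewrite mulrA -exprS subSn //.
    exact: ltnW.
  rewrite mulrDr mulrCA [D ^+ k.+2]exprS.
  apply: (@le_trans _ _ (B * D ^+ k.+1 + e * B ^+ 2 * D ^+ k.+1)).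
    by rewrite [e * (B ^+ 2 * _)]mulrA lerD2r ler_wpM2l //; lra.
  by rewrite -mulrDl ler_wpM2r // exprn_ge0; lra.
exists D => //; elim/ltn_ind => -[|k] IH.
  rewrite inv_coefE big_ord0 mulr0 add0r mul1r -/e expr1 /D; lra.
rewrite inv_coefE mul0r addr0 normcM normcN -/e.
apply: le_trans (S k.+1); apply: ler_wpM2l => //.
apply: le_trans (normc_sum _) _; apply: ler_sum => i _.
by rewrite normcM; apply: ler_pM; rewrite ?normc_ge0 // IH.
Qed.

Lemma rep_neq0 (x : puiseux) m n a : x != 0 -> (0 < m)%N ->
  pcoef x = emb m n a -> exists k, a k != 0.
Proof.
move=> x0 m0 xE; apply/not_existsP => h; move/eqP: x0; apply.
apply: puiseux_inj => r.
have [[k ->]|hr] := pselect (exists k, r = pexp m n k); last by rewrite xE emb0.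
by rewrite xE embE //; move/negP/negPn/eqP: (h k).
Qed.

Lemma pinv_ex (x : puiseux) : x != 0 -> exists y, y * x = 1.
Proof.
move=> x0; have [m [n [m0 [a ga xE] _ _]]] := rep3 x x x.
have ex := rep_neq0 x0 m0 xE.
case: (ex_minnP ex) => k0 ak0 mink.
pose b k := a (k + k0)%N.
have b0 : b 0%N != 0 by [].
have gb : geom b.
  case: ga => B B1 hB; exists (B ^+ k0.+1).
    by have := exp_mono (i := 0) (j := k0.+1) B1 (lexx _) isT; rewrite expr0.
  move=> k; apply: le_trans (hB _) _; rewrite -exprM; apply: exp_mono => //; nia.
have eE k : pexp m (n + k0%:Z) k = pexp m n (k + k0)%N.
  by rewrite /pexp PoszD [k%:Z + _]addrC addrA.
have xE' : pcoef x = emb m (n + k0%:Z) b.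
  apply: embP => // [k|r hr]; first by rewrite eE xE embE.
  have [[k rk]|h] := pselect (exists k, r = pexp m n k); last by rewrite xE emb0.
  rewrite xE rk embE //; apply: contra_notP hr => /eqP /mink kk.
  by exists (k - k0)%N; rewrite eE subnK.
have py : is_puiseux (emb m (- (n + k0%:Z)) (inv_coef b)).
  apply/is_puiseuxP; exists m, (- (n + k0%:Z)); split=> //.
  by exists (inv_coef b) => //; exact: geom_inv.
exists (Puiseux py); apply: puiseux_inj => r.
change (pmulf (emb m (- (n + k0%:Z)) (inv_coef b)) x r = pone r).
by rewrite xE' emb_mul // cauchy_prod_inv // addNr (pone_emb m0).
Qed.

Definition pinv (x : puiseux) : puiseux :=
  if pselect (exists y, y * x = 1) is left h then projT1 (cid h) else 0.

Lemma pmulV x : x != 0 -> pinv x * x = 1.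
Proof.
move=> x0; rewrite /pinv; case: pselect => [h|[]]; last exact: pinv_ex.
by case: (cid h).
Qed.

Lemma pinv0 : pinv 0 = 0.
Proof.
rewrite /pinv; case: pselect => // h; exfalso; case: h => y /eqP.
by rewrite mulr0 eq_sym oner_eq0.
Qed.

HB.instance Definition _ := GRing.ComNzRing_isField.Build puiseux pmulV pinv0.

(* The supremum of [- r] over the support, i.e. minus its least element
   ([Val_min]), and -oo for the zero series. *)
Definition Val (x : puiseux) : \bar R :=
  ereal_sup [set (- ratr r)%:E | r in [set r : rat | x r != 0]].

Lemma Val0 : Val 0 = -oo%E.
Proof.
rewrite /Val (_ : [set _ | _ in _] = set0) ?ereal_sup0 //.
by apply/seteqP; split=> // y [r /=]; rewrite eqxx.
Qed.

Lemma Val_min (x : puiseux) : x != 0 -> exists2 r : rat,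
  x r != 0 /\ (forall s, x s != 0 -> r <= s) & Val x = (- ratr r)%:E.
Proof.
move=> x0; have [m [n [m0 [a ga xE] _ _]]] := rep3 x x x.
have [k0 ak0 mink] : exists2 k0, a k0 != 0 & forall k, a k != 0 -> (k0 <= k)%N.
  have [k0 ak0 mink] := ex_minnP (rep_neq0 x0 m0 xE); by exists k0.
have xk0 : x (pexp m n k0) != 0 by rewrite xE embE.
have le s : x s != 0 -> pexp m n k0 <= s.
  rewrite xE; have [[k ->]|h] := pselect (exists k, s = pexp m n k); last first.
    by rewrite emb0 // eqxx.
  rewrite embE // => /mink kk; apply: ler_wpM2r; first by rewrite invr_ge0 ler0n.
  by rewrite ler_int; lia.
exists (pexp m n k0) => //; apply/eqP; rewrite eq_le; apply/andP; split.
  apply: ge_ereal_sup => _ [s /= hs <-].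
  by rewrite lee_fin lerN2 ler_rat le.
by apply: ereal_sup_ubound; exists (pexp m n k0).
Qed.

End Puiseux.

Section SingularHypersurfaces.
Variables (K : fieldType) (n : nat) (w : 'I_n -> 'rV[int]_3).

Definition monomial (z : 'rV[K]_3) (u : 'rV[int]_3) : K :=
  \prod_(j < 3) z 0 j ^ u 0 j.

(* [a i] is the coefficient of the monomial [z^(w i)]. *)
Definition laurent (a : 'I_n -> K) (z : 'rV[K]_3) : K :=
  \sum_i a i * monomial z (w i).

Definition laurent_deriv (a : 'I_n -> K) (j : 'I_3) (z : 'rV[K]_3) : K :=
  \sum_i a i * (w i 0 j)%:~R * monomial z (w i - delta_mx 0 j).

Definition sing_family : set ('I_n -> K) :=
  [set a | (exists i, a i != 0) /\
    exists z : 'rV[K]_3, [/\ forall j, z 0 j != 0,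
      laurent a z = 0 & forall j, laurent_deriv a j z = 0]].

Definition zariski_closure (X : set ('I_n -> K)) : set ('I_n -> K) :=
  [set a | forall G : mpoly.mpoly n K,
    (forall b, X b -> mpoly.meval b G = 0) -> mpoly.meval a G = 0].

(* [sing_family] is the affine cone over a subset of the linear system
   [P^(n-1)]; that subset is (dense in) a hypersurface iff the closure of the
   cone is the zero locus of a nonconstant polynomial. *)
Definition nondefective : Prop :=
  exists2 D : mpoly.mpoly n K, (forall d : K, D <> mpoly.mpolyC n d) &
    forall a, zariski_closure sing_family a <-> mpoly.meval a D = 0.

End SingularHypersurfaces.

Section LatticePolytopes.
Variable R : realType.

Definition pt (u : 'rV[int]_3) : 'rV[R]_3 := map_mx intr u.
Definition rpt (u : 'rV[rat]_3) : 'rV[R]_3 := map_mx ratr u.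
Definition dot (u u' : 'rV[R]_3) : R := \sum_(j < 3) u 0 j * u' 0 j.

Definition convex_weights m (l : 'I_m -> R) : Prop :=
  (forall i, 0 <= l i) /\ \sum_i l i = 1.

Definition convex_hull (A : set 'rV[R]_3) : set 'rV[R]_3 :=
  [set y | exists m (p : 'I_m -> 'rV[R]_3) (l : 'I_m -> R),
    [/\ forall i, A (p i), convex_weights l & y = \sum_i l i *: p i]].

Definition segment (p q : 'rV[R]_3) : set 'rV[R]_3 := convex_hull [set p; q].

Definition lattice_polytope (Delta : set 'rV[R]_3) : Prop :=
  exists V : seq 'rV[int]_3, Delta = convex_hull (pt @` [set` V]).

Definition lattice_points (Delta : set 'rV[R]_3) : set 'rV[int]_3 :=
  [set u | Delta (pt u)].

Definition prec (v : 'rV[rat]_3) (u u' : 'rV[int]_3) : Prop :=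
  0 < dot (pt u' - pt u) (rpt v).

Definition ordered_lattice_points (Delta : set 'rV[R]_3) (v : 'rV[rat]_3)
    n (w : 'I_n -> 'rV[int]_3) : Prop :=
  range w = lattice_points Delta /\
  forall i j : 'I_n, (i < j)%N -> prec v (w i) (w j).

Definition differences_generate n (w : 'I_n -> 'rV[int]_3) : Prop :=
  forall u : 'rV[int]_3, exists z : 'I_n -> 'I_n -> int,
    u = \sum_i \sum_j (w i - w j) *~ z i j.

(* The row space of [direction w B] is the direction of the affine span of the
   points [w i], [i \in B]. *)
Definition direction n (w : 'I_n -> 'rV[int]_3) (B : {set 'I_n}) : 'M[R]_3 :=
  (\sum_(i in B) \sum_(j in B) <<pt (w i) - pt (w j)>>)%MS.

(* The affine spans of dimension 0 must be left out: every vector is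
   orthogonal to the zero direction. *)
Definition general_direction (v : 'rV[rat]_3)
    n (w : 'I_n -> 'rV[int]_3) : Prop :=
  forall B : {set 'I_n}, (0 < \rank (direction w B) < 3)%N ->
    ~ (rpt v <= direction w B)%MS /\
    ~ (forall d : 'rV[R]_3, (d <= direction w B)%MS -> dot d (rpt v) = 0).

(* Mikhalkin's position: the points [M_i v], indexed from 0. *)
Definition fast_growing (L : rat) N (M : 'I_N -> rat) : Prop :=
  (forall i : 'I_N, i = 0%N :> nat -> L < M i) /\
  (forall i j : 'I_N, j = i.+1 :> nat -> L < M j / M i).

Definition mikhalkin_points (v : 'rV[rat]_3) N (M : 'I_N -> rat) :
    'I_N -> 'rV[R]_3 :=
  fun i => ratr (M i) *: rpt v.

End LatticePolytopes.

Section TropicalSurfaces.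
Variables (R : realType) (Delta : set 'rV[R]_3) (n : nat).
Variable w : 'I_n -> 'rV[int]_3.

(* A tropical surface is given by the coefficients [c i] of its tropical
   polynomial at [w i]; [c i = -oo] when the monomial is absent. *)
Implicit Type c : 'I_n -> \bar R.

Local Open Scope ereal_scope.

Definition trop_poly c (X : 'rV[R]_3) : \bar R :=
  \big[maxe/-oo]_i (c i + (dot (pt R (w i)) X)%:E).

Definition tropical_surface c : set 'rV[R]_3 :=
  [set X | exists i j, [/\ i != j,
    c i + (dot (pt R (w i)) X)%:E = trop_poly c X &
    c j + (dot (pt R (w j)) X)%:E = trop_poly c X]].

(* The lower boundary of the convex hull of the points [(w i, - c i)]; it is
   +oo outside the Newton polytope. *)
Definition nu c (y : 'rV[R]_3) : \bar R :=
  ereal_inf [set \sum_i (l i)%:E * - c i | l in [set l : 'I_n -> R |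
    convex_weights l /\ y = (\sum_i l i *: pt R (w i))%R]].

(* The part of [Delta] where [nu c] agrees with its supporting affine function
   of slope [X]: a linearity domain of [nu c] or a face of one. *)
Definition cell c (X : 'rV[R]_3) : set 'rV[R]_3 :=
  [set y | Delta y /\ forall z, Delta z ->
    nu c y - (dot y X)%:E <= nu c z - (dot z X)%:E].

Definition subdivision c : set (set 'rV[R]_3) := range (cell c).

Definition is_edge c (e : set 'rV[R]_3) : Prop :=
  subdivision c e /\ exists p q : 'rV[R]_3, p != q /\ e = segment p q.

(* The relative interior of the face of the tropical surface dual to [e]. *)
Definition dual_face_interior c (e : set 'rV[R]_3) : set 'rV[R]_3 :=
  [set X | cell c X = e].

Definition surface_path c N (x : 'I_N -> 'rV[R]_3) : set (set 'rV[R]_3) :=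
  [set e | is_edge c e /\ exists i, dual_face_interior c e (x i)].

Definition lattice_path (A : {set 'I_n}) : set (set 'rV[R]_3) :=
  [set e | exists i j : 'I_n, [/\ i \in A, j \in A, (i < j)%N,
    forall l : 'I_n, l \in A -> ~~ (i < l < j)%N &
    e = segment (pt R (w i)) (pt R (w j))]].

Definition Gamma (k : nat) : set (set 'rV[R]_3) :=
  lattice_path [set i : 'I_n | (i <= k)%N]%SET `|`
  lattice_path [set i : 'I_n | (k < i)%N]%SET.

Definition extends (P Sigma : set (set 'rV[R]_3)) c N (x : 'I_N -> 'rV[R]_3) :
    Prop :=
  Sigma = subdivision c /\ P = surface_path c x.

Definition sing_trop : set ('I_n -> \bar R) :=
  [set c | exists2 a : 'I_n -> puiseux R, sing_family w a &
    c = fun i => Val (a i)].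

Definition sing_trop_through N (x : 'I_N -> 'rV[R]_3) : set ('I_n -> \bar R) :=
  [set c | sing_trop c /\ forall i, tropical_surface c (x i)].

Local Open Scope ring_scope.

(* Sets of lattice points of [Delta] are given by their indices. *)
Definition affinely_dependent (C : {set 'I_n}) : Prop :=
  exists l : 'I_n -> R, [/\ exists2 i, i \in C & l i != 0,
    \sum_(i in C) l i = 0 & \sum_(i in C) l i *: pt R (w i) = 0].

Definition circuit (C : {set 'I_n}) : Prop :=
  affinely_dependent C /\
  forall B : {set 'I_n}, B \proper C -> ~ affinely_dependent B.

Definition circuit_of (Sigma : set (set 'rV[R]_3)) (C : {set 'I_n}) : Prop :=
  circuit C /\ exists2 D, Sigma D & forall i, i \in C -> D (pt R (w i)).

Definition type_D (C : {set 'I_n}) : Prop :=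
  (exists p q r s : 'I_n, [/\ C = [set p; q; r; s]%SET, #|C| = 4%N,
    ~ affinely_dependent [set p; q; r]%SET & w p + w s = w q + w r]) /\
  forall u : 'rV[int]_3,
    convex_hull [set pt R (w i) | i in [set` C]] (pt R u) ->
    exists2 i, i \in C & u = w i.

End TropicalSurfaces.

(* Main.v *)
Require Import Defs.
From mathcomp Require Import all_boot all_order all_algebra.
From mathcomp Require Import all_classical all_reals all_analysis.
From mathcomp Require Import lra zify.
Set Implicit Arguments.
Unset Strict Implicit.
Unset Printing Implicit Defensive.
Import Order.TTheory GRing.Theory Num.Theory.
Local Open Scope ring_scope.

(** Every lattice point [w_j] is an endpoint of a segment of [Gamma_{k,k+1}],
    hence lies in the cell dual to some point [t v] of the configuration, so
    [nu] has a supporting affine function at [w_j] whose linear part is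
    [t <., v>]. Restricted to the lattice points, [nu] is therefore a convex
    function of [<w_j, v>]. On a parallelogram [p < q < r < s], [p + s = q + r],
    contained in a cell, [nu] satisfies [nu p + nu s = nu q + nu r]; convexity
    then forces the supporting functions at [q] and [r] to agree and to be
    attained at [p] too. So three lattice points lie in the cell dual to some
    [t v], which is a segment with no lattice points besides its ends. *)

Section DotProduct.
Variable R : realType.
Implicit Types x y z : 'rV[R]_3.

Lemma dotDl x y z : dot (x + y) z = dot x z + dot y z.
Proof. by rewrite /dot -big_split; apply: eq_bigr => j _; rewrite mxE mulrDl. Qed.

Lemma dotZl a x z : dot (a *: x) z = a * dot x z.
Proof. by rewrite /dot mulr_sumr; apply: eq_bigr => j _; rewrite mxE mulrA. Qed.

Lemma dotBl x y z : dot (x - y) z = dot x z - dot y z.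
Proof. by rewrite dotDl -scaleN1r dotZl mulN1r. Qed.

Lemma dotZr a x z : dot x (a *: z) = a * dot x z.
Proof. by rewrite /dot mulr_sumr; apply: eq_bigr => j _; rewrite mxE mulrCA. Qed.

Lemma dot_suml m (F : 'I_m -> 'rV[R]_3) z :
  dot (\sum_i F i) z = \sum_i dot (F i) z.
Proof.
rewrite /dot exchange_big; apply: eq_bigr => j _ /=.
by rewrite summxE mulr_suml.
Qed.

(** Confines the lattice points of a segment to the range of heights [dot _ z] between its ends. *)
Lemma dot_segment x y u z : segment x y u -> dot x z <= dot y z ->
  dot x z <= dot u z <= dot y z.
Proof.
case=> m [g [l [hg [l0 l1] ->]]] xy; rewrite dot_suml.
have hd i : dot x z <= dot (g i) z <= dot y z.
  by case: (hg i) => ->; rewrite lexx xy.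
have split1 c : c = \sum_i l i * c by rewrite -mulr_suml l1 mul1r.
rewrite [X in X <= _]split1 [X in _ && (_ <= X)]split1.
apply/andP; split; apply: ler_sum => i _; rewrite dotZl ler_wpM2l //.
  by case/andP: (hd i).
by case/andP: (hd i).
Qed.

Lemma ptD u u' : pt R (u + u') = pt R u + pt R u'.
Proof. by rewrite /pt map_mxD. Qed.

End DotProduct.

Lemma segment_endl (R : realType) (x y : 'rV[R]_3) : segment x y x.
Proof.
exists 1%N, (fun=> x), (fun=> 1); split; first by left.
  by split=> //; rewrite big_ord1.
by rewrite big_ord1 scale1r.
Qed.

Lemma segment_endr (R : realType) (x y : 'rV[R]_3) : segment x y y.
Proof.
exists 1%N, (fun=> y), (fun=> 1); split; first by right.
  by split=> //; rewrite big_ord1.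
by rewrite big_ord1 scale1r.
Qed.

(** Compare chord slopes of [b] against [f]. From [q] to [r] the slope is at least [t] and at most
    [t']. From [p] to [q] it is at most [t]; the two sum relations make it equal to the slope from
    [r] to [s], which is at least [t']. Hence [t = t'], and both chords have exactly this slope. *)
Lemma supporting_slopes_eq (R : realFieldType) (I : Type) (b f : I -> R)
    (p q r s : I) (t t' : R) :
    (forall i, b q - t * f q <= b i - t * f i) ->
    (forall i, b r - t' * f r <= b i - t' * f i) ->
    f p + f s = f q + f r -> b p + b s = b q + b r ->
    f p < f q -> f q < f r ->
  b p - t * f p = b q - t * f q /\ b r - t * f r = b q - t * f q.
Proof.
move=> hq hr ef eb pq qr.
have hqp := hq p; have hqr := hq r; have hrq := hr q; have hrs := hr s.
have tt' : t = t'.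
  apply/eqP; rewrite eq_le; apply/andP; split.
    rewrite -(@ler_pM2r _ (f r - f q)) ?subr_gt0 //; lra.
  rewrite -(@ler_pM2r _ (f q - f p)) ?subr_gt0 //.
  have fs : f s = f q + f r - f p by lra.
  by rewrite fs in hrs; lra.
subst t'; have fs : f s = f q + f r - f p by lra.
by have := hq s; rewrite fs in hrs *; split; lra.
Qed.

Section SupportingFunctions.
Variables (R : realType) (Delta : set 'rV[R]_3) (n : nat).
Variables (w : 'I_n -> 'rV[int]_3) (c : 'I_n -> \bar R).
Local Notation P i := (pt R (w i)).
Hypothesis w_in : forall i, Delta (P i).
Hypothesis c_lty : forall i, (c i < +oo)%E.
Hypothesis c_fin : exists i, c i != -oo%E.

Lemma nu_le i : (nu w c (P i) <= - c i)%E.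
Proof.
apply: ereal_inf_lbound; exists (fun j => (j == i)%:R).
  split; first split.
  - by move=> j; rewrite ler0n.
  - by rewrite (bigD1 i) //= eqxx big1 ?addr0 // => j /negPf ->.
  - by rewrite (bigD1 i) //= eqxx scale1r big1 ?addr0 // => j /negPf ->; rewrite scale0r.
(* Absent monomials do no harm: [0 * +oo = 0] in the extended reals. *)
rewrite (bigD1 i) //= eqxx mul1e big1 ?adde0 // => j /negPf ->.
by rewrite mul0e.
Qed.

Lemma nu_gtNy y : (-oo < nu w c y)%E.
Proof.
have [B hB] : exists B : R, forall i, (B%:E <= - c i)%E.
  (* Where [c i = -oo], [fine] contributes 0 to the sum and [- c i = +oo] satisfies any bound. *)
  exists (- \sum_i `|fine (c i)|) => i.
  rewrite EFinN leeN2; have := c_lty i; case ci : (c i) => [a| |] // _.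
    rewrite lee_fin (bigD1 i) //= ci /=.
    apply: le_trans (ler_norm a) _; rewrite lerDl; exact: sumr_ge0.
  exact: leNye.
apply: (@lt_le_trans _ _ B%:E); first exact: ltNyr.
apply: le_ereal_inf_tmp => _ [l [[l0 l1] _] <-].
have -> : B%:E = (\sum_i (l i)%:E * B%:E)%E.
  by under eq_bigr do rewrite -EFinM; rewrite sumEFin -mulr_suml l1 mul1r.
by apply: lee_sum => i _; rewrite lee_wpmul2l // lee_fin.
Qed.

(** The value [+oo] at [P i] would spread through the supporting inequality to every lattice point,
    against [nu_le] at an index [j] with [c j] finite. *)
Lemma cell_nu_fin X i : cell Delta w c X (P i) -> nu w c (P i) \is a fin_num.
Proof.
case=> _ h; have [j cj] := c_fin.
rewrite fin_numE gt_eqF ?nu_gtNy //=; apply/negP => /eqP nuy.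
have := h _ (w_in j); rewrite nuy /=.
have := nu_le j; have := c_lty j; have := nu_gtNy (P j); case: (c j) cj => // a _.
by case: (nu w c (P j)).
Qed.

Hypothesis covered : forall i, exists X, cell Delta w c X (P i).
Let b i := fine (nu w c (P i)).

Lemma nu_fine i : nu w c (P i) = (b i)%:E.
Proof. by have [X hX] := covered i; rewrite fineK // (cell_nu_fin hX). Qed.

Lemma cell_supporting X i : cell Delta w c X (P i) ->
  forall j, b i - dot (P i) X <= b j - dot (P j) X.
Proof. by case=> _ h j; have := h _ (w_in j); rewrite !nu_fine -!EFinB lee_fin. Qed.

Lemma cell_supporting_eq X i j : cell Delta w c X (P i) ->
  b j - dot (P j) X = b i - dot (P i) X -> cell Delta w c X (P j).
Proof.
move=> [_ h] e; split=> // z /h; apply: le_trans.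
by rewrite !nu_fine -!EFinB lee_fin e.
Qed.

Lemma cell_contains_three (u X0 : 'rV[R]_3) (t t' : R) p q r s :
    cell Delta w c (t *: u) (P q) -> cell Delta w c (t' *: u) (P r) ->
    [/\ cell Delta w c X0 (P p), cell Delta w c X0 (P q),
      cell Delta w c X0 (P r) & cell Delta w c X0 (P s)] ->
    w p + w s = w q + w r ->
    dot (P p) u < dot (P q) u -> dot (P q) u < dot (P r) u ->
  cell Delta w c (t *: u) (P p) /\ cell Delta w c (t *: u) (P r).
Proof.
move=> tq tr [Xp Xq Xr Xs] pqrs pq qr.
have par z : dot (P p) z + dot (P s) z = dot (P q) z + dot (P r) z.
  by rewrite -!dotDl -!ptD pqrs.
(* All four points minimise [b - dot _ X0], so [b] differs from [dot _ X0] by a constant on them and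
   inherits [par X0]. *)
have bpar : b p + b s = b q + b r.
  have := par X0.
  have := cell_supporting Xp s; have := cell_supporting Xs p.
  have := cell_supporting Xp q; have := cell_supporting Xq p.
  have := cell_supporting Xp r; have := cell_supporting Xr p.
  lra.
have hq i : b q - t * dot (P q) u <= b i - t * dot (P i) u.
  by rewrite -!dotZr; exact: cell_supporting.
have hr i : b r - t' * dot (P r) u <= b i - t' * dot (P i) u.
  by rewrite -!dotZr; exact: cell_supporting.
have [ep er] := supporting_slopes_eq hq hr (par u) bpar pq qr.
by split; apply: (cell_supporting_eq tq); rewrite !dotZr.
Qed.

End SupportingFunctions.

Lemma Gamma_covers (R : realType) N (w : 'I_N.+2 -> 'rV[int]_3) k (i : 'I_N.+2) :
  (1 <= k < N)%N -> exists2 e, Gamma (R := R) w k e & e (pt R (w i)).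
Proof.
move=> /andP[k1 kN].
have edge (j j' : 'I_N.+2) : j' = j.+1 :> nat -> j <> k :> nat ->
    Gamma (R := R) w k (segment (pt R (w j)) (pt R (w j'))).
  move=> jj' jk; have [jlt|jge] := ltnP j k; [left|right];
    exists j, j'; split=> //; rewrite ?inE; try lia; move=> l _; lia.
have ilt := ltn_ord i.
(* The edge to the successor is missing only at the gap [k] and at the end [N.+1]. There the edge
   from the predecessor serves: [1 <= k] provides it at [k], and [k < N] keeps it off the gap at
   [N.+1]. *)
have [last|notlast] := boolP ((i == k :> nat) || (i == N.+1 :> nat)).
  have i'lt : (i.-1 < N.+2)%N by lia.
  exists (segment (pt R (w (Ordinal i'lt))) (pt R (w i))); last exact: segment_endr.
  by apply: edge => /=; lia.
have i'lt : (i.+1 < N.+2)%N by lia.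
exists (segment (pt R (w i)) (pt R (w (Ordinal i'lt)))); last exact: segment_endl.
by apply: edge => //=; lia.
Qed.

(** Both index sets defining [Gamma] are intervals, so each of its segments joins neighbours in the
    order of all lattice points. As heights increase with the index, no third index fits between two
    points on it. *)
Lemma Gamma_ends_adjacent (R : realType) N (w : 'I_N.+2 -> 'rV[int]_3) (u : 'rV[R]_3)
    k e (p q r : 'I_N.+2) :
    (forall i j : 'I_N.+2, (i < j)%N -> dot (pt R (w i)) u < dot (pt R (w j)) u) ->
    Gamma (R := R) w k e -> e (pt R (w p)) -> e (pt R (w r)) ->
  ~~ (p < q < r)%N.
Proof.
move=> mono He ep er; apply/negP => /andP[pq qr].
have [i [j [ij empty ee]]] : exists i j : 'I_N.+2, [/\ (i < j)%N,
    forall l : 'I_N.+2, ~~ (i < l < j)%N &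
    e = segment (pt R (w i)) (pt R (w j))].
  case: He => -[i [j [iA jA ij h ->]]]; exists i, j; split=> // l;
    apply/negP => ilj; have := h l; rewrite ilj !inE in iA jA *; lia.
rewrite ee in ep er; have ij' := ltW (mono _ _ ij).
have /andP[ip _] := dot_segment ep ij'.
have /andP[_ rj] := dot_segment er ij'.
have ip' : (i <= p)%N by rewrite leqNgt; apply/negP => /mono; rewrite ltNge ip.
have rj' : (r <= j)%N by rewrite leqNgt; apply/negP => /mono; rewrite ltNge rj.
by have := empty q; rewrite (leq_ltn_trans ip' pq) (leq_trans qr rj').
Qed.

Theorem lemma3p11 (R : realType) (Delta : set 'rV[R]_3) (v : 'rV[rat]_3)
    (N : nat) (w : 'I_N.+2 -> 'rV[int]_3)
    (hDelta : lattice_polytope Delta)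
    (hw : ordered_lattice_points Delta v w)
    (hgen : differences_generate w)
    (hN : (0 < N)%N)
    (hnd : nondefective (puiseux R) w)
    (hv : general_direction R v w) :
  exists L : rat, forall M : 'I_N -> rat, fast_growing L M ->
    let x := mikhalkin_points R v M in
    forall k : nat, (1 <= k < N)%N ->
      ~ exists (Sigma : set (set 'rV[R]_3)) (S : 'I_N.+2 -> \bar R)
          (C : {set 'I_N.+2}),
        [/\ sing_trop_through w x S, extends Delta w (Gamma w k) Sigma S x,
            circuit_of w Sigma C & type_D R w C].
Proof.
exists 0 => M _ x k hk [Sigma [S [C []]]].
move=> [[a [[i0 ai0] _] SE] _] [-> GE] [_ [_ [X0 _ <-] hC]].
case=> -[p [q [r [s [CE C4 _ pqrs]]]]] _.
have w_in i : Delta (pt R (w i)).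
  by have : lattice_points Delta (w i) by rewrite -hw.1; exists i.
have mono (i j : 'I_N.+2) : (i < j)%N ->
    dot (pt R (w i)) (rpt R v) < dot (pt R (w j)) (rpt R v).
  by move=> /hw.2; rewrite /prec dotBl subr_gt0.
have S_lty i : (S i < +oo)%E.
  rewrite SE; have [->|/Val_min[t _ ->]] := eqVneq (a i) 0; last exact: ltry.
  by rewrite Val0.
have S_fin : exists i, S i != -oo%E.
  by exists i0; rewrite SE; have [t _ ->] := Val_min ai0.
(* By [GE], the segment of [Gamma] through [w i] is the cell dual to some [x j], whence the slope
   [t = M j]. *)
have cov i : exists2 t : R, cell Delta w S (t *: rpt R v) (pt R (w i)) &
    Gamma (R := R) w k (cell Delta w S (t *: rpt R v)).
  have [e] := Gamma_covers R w i hk => Ge; have := Ge.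
  rewrite {1}GE => -[_ [j]]; rewrite /dual_face_interior /= => ej ei.
  by rewrite -ej in Ge ei; exists (ratr (M j)).
have covX i : exists X, cell Delta w S X (pt R (w i)).
  by have [t ht _] := cov i; exists (t *: rpt R v).
(* The place of [s'] in the order is left open, so that both final cases below are instances. *)
have main p' q' r' s' : C = [set p'; q'; r'; s']%SET ->
    w p' + w s' = w q' + w r' -> (p' < q')%N -> (q' < r')%N -> False.
  move=> C' e pq qr.
  have inC i : i \in [set p'; q'; r'; s']%SET -> cell Delta w S X0 (pt R (w i)).
    by rewrite -C'; exact: hC.
  have [t tq Gt] := cov q'; have [t' tr _] := cov r'.
  have X4 : [/\ cell Delta w S X0 (pt R (w p')), cell Delta w S X0 (pt R (w q')),
      cell Delta w S X0 (pt R (w r')) & cell Delta w S X0 (pt R (w s'))].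
    by split; apply: inC; rewrite !inE eqxx ?orbT.
  have [tp {}tr] := cell_contains_three w_in S_lty S_fin covX tq tr X4 e
    (mono _ _ pq) (mono _ _ qr).
  by have := Gamma_ends_adjacent q' mono Gt tp tr; rewrite pq qr.
have uniqC : uniq [:: p; q; r; s].
  apply/card_uniqP; rewrite /= -C4 CE; apply: eq_card => z.
  by rewrite !inE; do 4! case: (z == _).
(* The diagonals are [p], [s] and [q], [r]. Each is oriented upward by swapping its ends; the least
   vertex is then [p] or [q], and exchanging the two diagonals settles the second case. *)
wlog ps : p q r s CE pqrs uniqC / (p < s)%N => [IH|].
  have : p != s by move: uniqC; rewrite /= !inE !negb_or => /and4P[/and3P[]].
  rewrite neq_ltn => /orP[|sp]; first exact: (IH p q r s).
  apply: (IH s q r p) => //; last 1 first.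
  - by rewrite (perm_uniq (_ : perm_eq _ [:: p; q; r; s])) //; apply/permP => z /=; lia.
  - by rewrite CE; apply/setP => z; rewrite !inE; do 4! case: (z == _).
  - by rewrite addrC.
wlog qr : q r CE pqrs uniqC / (q < r)%N => [IH|].
  have : q != r by move: uniqC; rewrite /= !inE !negb_or => /and4P[_ /andP[]].
  rewrite neq_ltn => /orP[|rq]; first exact: (IH q r).
  apply: (IH r q) => //; last 1 first.
  - by rewrite (perm_uniq (_ : perm_eq _ [:: p; q; r; s])) //; apply/permP => z /=; lia.
  - by rewrite CE; apply/setP => z; rewrite !inE; do 4! case: (z == _).
  - by rewrite pqrs addrC.
have : p != q by move: uniqC; rewrite /= !inE !negb_or => /and4P[/and3P[]].
rewrite neq_ltn => /orP[pq|qp]; first exact: (main p q r s).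
apply: (main q p s r) => //.
by rewrite CE; apply/setP => z; rewrite !inE; do 4! case: (z == _).
Qed.
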